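(* Let $H$ be a Hopf algebra over $\Bbbk$ and let $A$ be an $H$-module Poisson algebra. Let $U(A)$ be the universal enveloping algebra of the Poisson algebra $A$, with generators $\mu_a,\nu_a$ ($a\in A$). Then $U(A)$ is an $H$-module algebra via the action $$h\cdot \mu_a=\mu_{h\cdot a},\qquad h\cdot \nu_a=\nu_{h\cdot a}\qquad (h\in H,\ a\in A)$$ if and only if $$\mu_{h_1\cdot b}\,\nu_{h_2\cdot a}=\mu_{h_2\cdot b}\,\nu_{h_1\cdot a}\qquad\text{and}\qquad \nu_{h_2\cdot b}\,\nu_{h_1\cdot a}=\nu_{h_1\cdot b}\,\nu_{h_2\cdot a}$$ in $U(A)$ for all $h\in H$ and all $a,b\in A$.
   Context: $\Bbbk$ is an algebraically closed field of characteristic zero; all algebras are $\Bbbk$-algebras. A Poisson algebra is a commutative algebra $A$ with a bilinear bracket $\{-,-\}$ such that $(A,\{-,-\})$ is a Lie algebra and each $\{a,-\}$ is a derivation of $A$. Sumless Sweedler notation is used: $\Delta(h)=h_1\otimes h_2$ (summation understood). An algebra $A$ is a (left) $H$-module algebra if it is a left $H$-module with $h\cdot 1_A=\epsilon(h)1_A$ and $h\cdot(ab)=(h_1\cdot a)(h_2\cdot b)$. A Poisson algebra $A$ is an $H$-module Poisson algebra if it is an $H$-module algebra and $h\cdot\{a,b\}=\{h_1\cdot a,h_2\cdot b\}$ for all $h\in H$, $a,b\in A$. The universal enveloping algebra $U(A)$ of a Poisson algebra $A$ is the associative unital $\Bbbk$-algebra generated by elements $\mu_a,\nu_a$ for $a\in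 A$, where $a\mapsto\mu_a$ and $a\mapsto \nu_a$ are $\Bbbk$-linear, subject to the relations, for all $a,b\in A$: $\mu_{ab}=\mu_a\mu_b$, $\mu_{\{a,b\}}=\nu_a\mu_b-\mu_b\nu_a$, $\mu_1=1$, $\nu_{ab}=\mu_b\nu_a+\mu_a\nu_b$, $\nu_{\{a,b\}}=\nu_a\nu_b-\nu_b\nu_a$. ''Via the action'' means that there is an $H$-module algebra structure on $U(A)$ given on the generators by the displayed formulas. *)

(* Defs.v *)
From HB Require Import structures.
From mathcomp Require Import all_boot all_order all_algebra.
From mathcomp Require Import finmap boolp.
From mathcomp.multinomials Require Import monalg.

Set Implicit Arguments.
Unset Strict Implicit.
Unset Printing Implicit Defensive.

Import GRing.Theory.

Local Open Scope ring_scope.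
Local Open Scope quotient_scope.

Inductive span (k : fieldType) (V : lmodType k) (S : V -> Prop) : V -> Prop :=
| span_zero : span S 0
| span_cons (c : k) (x y : V) : S x -> span S y -> span S (c *: x + y).

Section QuotientSpace.
Variables (k : fieldType) (V : lmodType k) (S : V -> Prop).

Definition spanb : {pred V} := fun x => `[< span S x >].

Lemma spanbP x : reflect (span S x) (x \in spanb).
Proof. exact: asboolP. Qed.

Lemma span_gen x : S x -> span S x.
Proof. by move=> Sx; have := span_cons 1 Sx (span_zero S); rewrite scale1r addr0. Qed.

Lemma spanD x y : span S x -> span S y -> span S (x + y).
Proof.
move=> Sx Sy; elim: Sx => [|c u v Su _ IHv]; first by rewrite add0r.
by rewrite -addrA; exact: span_cons.
Qed.

Lemma spanZ c x : span S x -> span S (c *: x).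
Proof.
elim=> [|d u v Su _ IHv]; first by rewrite scaler0; exact: span_zero.
by rewrite scalerDr scalerA; exact: span_cons.
Qed.

Lemma spanb_zmod_closed : zmod_closed spanb.
Proof.
split=> [|x y /spanbP Sx /spanbP Sy]; apply/spanbP; first exact: span_zero.
by apply: spanD => //; rewrite -scaleN1r; exact: spanZ.
Qed.

HB.instance Definition _ := GRing.isZmodClosed.Build V spanb spanb_zmod_closed.

Definition qspace := Quotient.quot spanb.

HB.instance Definition _ := GRing.Zmodule.on qspace.

Definition qclass (x : V) : qspace := \pi_(Quotient.quot spanb) x.

Lemma qclassP x y : qclass x = qclass y <-> span S (x - y).
Proof.
split=> [/eqP|Sxy].
  by rewrite /qclass -(@Quotient.idealrBE V) => /spanbP.
by apply/eqP; rewrite /qclass -(@Quotient.idealrBE V); apply/spanbP.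
Qed.

Definition qrepr (x : qspace) : V := repr (x : Quotient.quot spanb).

Lemma qreprK : cancel qrepr qclass.
Proof. exact: reprK. Qed.

Lemma qclassD : {morph qclass : x y / x + y}.
Proof. exact: (raddfD \pi_(Quotient.quot spanb)). Qed.

Fact qscale_key : unit. Proof. exact: tt. Qed.
Definition qscale : k -> qspace -> qspace :=
  locked_with qscale_key (fun c x => qclass (c *: qrepr x)).

Lemma qclassZ c x : qclass (c *: x) = qscale c (qclass x).
Proof.
rewrite /qscale unlock; apply/qclassP; rewrite -scalerBr; apply: spanZ.
by apply/qclassP; rewrite qreprK.
Qed.

Lemma qscaleA a b x : qscale a (qscale b x) = qscale (a * b) x.
Proof. by rewrite -[x]qreprK -!qclassZ scalerA. Qed.

Lemma qscale1 : left_id 1 qscale.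
Proof. by move=> x; rewrite -[x]qreprK -!qclassZ scale1r. Qed.

Lemma qscaleDr : right_distributive qscale +%R.
Proof.
move=> c x y.
by rewrite -[x]qreprK -[y]qreprK -qclassD -!qclassZ -qclassD scalerDr.
Qed.

Lemma qscaleDl x : {morph qscale^~ x : a b / a + b}.
Proof. by move=> a b; rewrite -[x]qreprK -!qclassZ -qclassD scalerDl. Qed.

HB.instance Definition _ := GRing.Zmodule_isLmodule.Build k qspace
  qscaleA qscale1 qscaleDr qscaleDl.

Lemma qclass_is_linear : linear qclass.
Proof. by move=> c x y; rewrite qclassD qclassZ. Qed.

HB.instance Definition _ := GRing.isLinear.Build k V qspace *:%R qclass
  qclass_is_linear.

End QuotientSpace.

Section MalgLift.
Variables (k : fieldType) (K : choiceType) (W : lmodType k) (h : K -> W).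

Definition mlift (g : {malg k[K]}) : W := \sum_(p <- msupp g) g@_p *: h p.

Lemma mliftEw g (d : {fset K}) : (msupp g `<=` d)%fset ->
  mlift g = \sum_(p <- d) g@_p *: h p.
Proof.
move=> le; rewrite [LHS](big_fset_incl _ le) => //= p _ /mcoeff_outdom ->.
by rewrite scale0r.
Qed.

Lemma mlift_is_linear : linear mlift.
Proof.
move=> c g1 g2; pose d := (msupp g1 `|` msupp g2 `|` msupp (c *: g1 + g2))%fset.
have [s1 s2 s3] : [/\ msupp g1 `<=` d, msupp g2 `<=` d
                    & msupp (c *: g1 + g2) `<=` d]%fset.
  by split; apply/fsubsetP => p pg; rewrite !in_fsetU pg ?orbT.
rewrite (mliftEw s1) (mliftEw s2) (mliftEw s3).
rewrite scaler_sumr -big_split /=; apply: eq_bigr => p _.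
by rewrite mcoeffD mcoeffZ scalerDl scalerA.
Qed.

HB.instance Definition _ :=
  GRing.isLinear.Build k {malg k[K]} W *:%R mlift mlift_is_linear.

Lemma mliftU p : mlift << p >> = h p.
Proof. by rewrite (mliftEw msuppU_le) big_seq_fset1 mcoeffUU scale1r. Qed.

End MalgLift.

Lemma malg_ind (k : fieldType) (K : choiceType) (P : {malg k[K]} -> Prop) :
    P 0 -> (forall c p g, P g -> P (c *: << p >> + g)) ->
  forall g, P g.
Proof.
move=> P0 PD g; rewrite (monalgE g).
elim: (X in \sum_(p <- X) _) => [|p s IHs]; first by rewrite big_nil.
rewrite big_cons; have -> : << g@_p *g p >> = g@_p *: << p >> :> {malg k[K]}.
  by apply/malgP=> q; rewrite mcoeffZ !mcoeffU mulrnAr mulr1.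
exact: PD.
Qed.

Section Tensor.
Variables (k : fieldType) (U V : lmodType k).

Inductive tensor_rel : {malg k[(U * V)%type]} -> Prop :=
| tensor_relDl u u' v :
    tensor_rel (<< (u + u', v) >> - << (u, v) >> - << (u', v) >>)
| tensor_relDr u v v' :
    tensor_rel (<< (u, v + v') >> - << (u, v) >> - << (u, v') >>)
| tensor_relZl c u v : tensor_rel (<< (c *: u, v) >> - c *: << (u, v) >>)
| tensor_relZr c u v : tensor_rel (<< (u, c *: v) >> - c *: << (u, v) >>).

Definition tensor := qspace tensor_rel.

HB.instance Definition _ := GRing.Lmodule.on tensor.

Definition tens (u : U) (v : V) : tensor := qclass tensor_rel << (u, v) >>.

Lemma tens_is_bilinear : bilinear_for *:%R *:%R tens.
Proof.
have relE x y z : tensor_rel (x - y - z) ->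
    qclass tensor_rel x = qclass tensor_rel y + qclass tensor_rel z.
  move=> r; rewrite -qclassD; apply/qclassP.
  by rewrite opprD addrA; exact: span_gen.
have relZ c x y : tensor_rel (x - c *: y) ->
    qclass tensor_rel x = c *: qclass tensor_rel y.
  by move=> r; rewrite -linearZ; apply/qclassP; exact: span_gen.
split=> [v c u u'|u c v v']; rewrite /tens.
  rewrite (relE _ _ _ (tensor_relDl _ _ _)).
  by rewrite (relZ _ _ _ (tensor_relZl _ _ _)).
rewrite (relE _ _ _ (tensor_relDr _ _ _)).
by rewrite (relZ _ _ _ (tensor_relZr _ _ _)).
Qed.

Lemma tens_ind (P : tensor -> Prop) :
    (forall c u v t, P t -> P (c *: tens u v + t)) -> P 0 ->
  forall t, P t.
Proof.
move=> PD P0 t; rewrite -[t](@qreprK _ _ tensor_rel).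
elim/malg_ind: (qrepr t) => [|c [u v] g IHg]; first by rewrite linear0.
by rewrite linearP; exact: PD.
Qed.

(* Evaluated at a chosen representative, so meaningful when f is bilinear:    *)
(* it is then the linear map induced by f, see tliftE and tlift_is_linear     *)
Definition tlift (W : lmodType k) (f : U -> V -> W) (t : tensor) : W :=
  mlift (fun p => f p.1 p.2) (qrepr t).

Section TensorLift.
Variables (W : lmodType k) (f : U -> V -> W).
Hypothesis f_bilin : bilinear_for *:%R *:%R f.

Let flift := mlift (fun p : U * V => f p.1 p.2).

Let flift_rel g : span tensor_rel g -> flift g = 0.
Proof.
have [fl fr] := f_bilin.
have fDl u u' v : f (u + u') v = f u v + f u' v.
  by have := fl v 1 u u'; rewrite /= !scale1r.
have fDr u v v' : f u (v + v') = f u v + f u v'.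
  by have := fr u 1 v v'; rewrite /= !scale1r.
have f0l v : f 0 v = 0 by apply: (addrI (f 0 v)); rewrite -fDl !addr0.
have f0r u : f u 0 = 0 by apply: (addrI (f u 0)); rewrite -fDr !addr0.
elim=> [|c x y rx _ IHy]; first by rewrite /flift linear0.
rewrite /flift mlift_is_linear -/flift IHy addr0; suff -> : flift x = 0 by rewrite scaler0.
case: {c y IHy} rx => [u u' v|u v v'|c u v|c u v];
  rewrite /flift !linearB ?linearZ /= ?linearZ /= !mliftU /=.
- by rewrite fDl -addrA -opprD subrr.
- by rewrite fDr -addrA -opprD subrr.
- by have /= := fl v c u 0; rewrite !addr0 f0l addr0 => ->; rewrite scalerN subrr.
- by have /= := fr u c v 0; rewrite !addr0 f0r addr0 => ->; rewrite scalerN subrr.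
Qed.

Let tlift_class g : tlift f (qclass tensor_rel g) = flift g.
Proof.
apply/eqP; rewrite -subr_eq0; apply/eqP.
rewrite -[tlift _ _]/(flift _) /flift -linearB -/flift; apply: flift_rel.
by apply/qclassP; rewrite qreprK.
Qed.

Lemma tliftE u v : tlift f (tens u v) = f u v.
Proof. by rewrite /tens tlift_class /flift mliftU. Qed.

Lemma tlift_is_linear : linear (tlift f).
Proof.
move=> c s t; rewrite -[s](@qreprK _ _ tensor_rel) -[t](@qreprK _ _ tensor_rel).
by rewrite -linearP /= !tlift_class /flift linearP.
Qed.

End TensorLift.

End Tensor.

Arguments tens {k U V} u v.
Arguments tlift {k U V W} f t.

(* The span of this set is the two-sided ideal generated by S *)
Inductive ideal_span (k : fieldType) (F : algType k) (S : F -> Prop) : F -> Prop :=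
  ideal_span_mul x r y : S r -> ideal_span S (x * r * y).

Section QuotientAlgebra.
Variables (k : fieldType) (F : algType k) (S : F -> Prop).

Definition qalg := qspace (ideal_span S).

HB.instance Definition _ := GRing.Lmodule.on qalg.

Definition qpi (x : F) : qalg := qclass (ideal_span S) x.

Lemma ideal_spanMl x y : span (ideal_span S) y -> span (ideal_span S) (x * y).
Proof.
elim=> [|c _ z [u r v Sr] _ IHz]; first by rewrite mulr0; exact: span_zero.
rewrite mulrDr -scalerAr !mulrA.
by apply: span_cons => //; exact: ideal_span_mul.
Qed.

Lemma ideal_spanMr x y : span (ideal_span S) y -> span (ideal_span S) (y * x).
Proof.
elim=> [|c _ z [u r v Sr] _ IHz]; first by rewrite mul0r; exact: span_zero.
rewrite mulrDl -scalerAl -(mulrA (u * r)).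
by apply: span_cons => //; exact: ideal_span_mul.
Qed.

Lemma qpi_rel x y : S (x - y) -> qpi x = qpi y.
Proof.
move=> Sxy; apply/qclassP; apply: span_gen.
by rewrite -[x - y]mul1r -[1 * _]mulr1.
Qed.

Fact qmul_key : unit. Proof. exact: tt. Qed.
Definition qmul : qalg -> qalg -> qalg :=
  locked_with qmul_key (fun x y => qpi (qrepr x * qrepr y)).

Lemma qpiM x y : qpi (x * y) = qmul (qpi x) (qpi y).
Proof.
rewrite /qmul unlock; apply/qclassP; set x' := qrepr _; set y' := qrepr _.
have -> : x * y - x' * y' = (x - x') * y + x' * (y - y').
  by rewrite mulrBl mulrBr addrA subrK.
apply: spanD; [apply: ideal_spanMr | apply: ideal_spanMl];
  by apply/qclassP; rewrite qreprK.
Qed.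

Let qpiK (x : qalg) : qpi (qrepr x) = x. Proof. exact: qreprK. Qed.

Lemma qmulA : associative qmul.
Proof.
by move=> x y z; rewrite -[x]qpiK -[y]qpiK -[z]qpiK -!qpiM mulrA.
Qed.

Lemma qmul1 : left_id (qpi 1) qmul.
Proof. by move=> x; rewrite -[x]qpiK -qpiM mul1r. Qed.

Lemma qmulr1 : right_id (qpi 1) qmul.
Proof. by move=> x; rewrite -[x]qpiK -qpiM mulr1. Qed.

Let qpiD x y : qpi (x + y) = qpi x + qpi y. Proof. exact: qclassD. Qed.

Lemma qmulDl : left_distributive qmul +%R.
Proof.
move=> x y z; rewrite -[x]qpiK -[y]qpiK -[z]qpiK.
by rewrite -qpiD -!qpiM mulrDl qpiD.
Qed.

Lemma qmulDr : right_distributive qmul +%R.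
Proof.
move=> x y z; rewrite -[x]qpiK -[y]qpiK -[z]qpiK.
by rewrite -qpiD -!qpiM mulrDr qpiD.
Qed.

HB.instance Definition _ :=
  GRing.Zmodule_isPzRing.Build qalg qmulA qmul1 qmulr1 qmulDl qmulDr.

Let qpiZ c x : qpi (c *: x) = c *: qpi x. Proof. exact: qclassZ. Qed.

Lemma qscalerAl c (x y : qalg) : c *: (x * y) = (c *: x) * y.
Proof.
rewrite -[x]qpiK -[y]qpiK -[_ * _]qpiM -!qpiZ.
by rewrite -[RHS]qpiM scalerAl.
Qed.

Lemma qscalerAr c (x y : qalg) : c *: (x * y) = x * (c *: y).
Proof.
rewrite -[x]qpiK -[y]qpiK -[_ * _]qpiM -!qpiZ.
by rewrite -[RHS]qpiM scalerAr.
Qed.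

Lemma qpi_is_linear : linear qpi.
Proof. exact: linearP. Qed.

HB.instance Definition _ := GRing.isLinear.Build k F qalg *:%R qpi qpi_is_linear.

Lemma qpi_is_monoid_morphism : monoid_morphism qpi.
Proof. by split=> // x y; exact: qpiM. Qed.

Lemma qpi_relM a x y : S (a - x * y) -> qpi a = qpi x * qpi y.
Proof. by move=> /qpi_rel ->; rewrite qpiM. Qed.

Lemma qpi_relMB a x y z t :
  S (a - (x * y - z * t)) -> qpi a = qpi x * qpi y - qpi z * qpi t.
Proof. by move=> /qpi_rel ->; rewrite linearB /= !qpiM. Qed.

Lemma qpi_relMD a x y z t :
  S (a - (x * y + z * t)) -> qpi a = qpi x * qpi y + qpi z * qpi t.
Proof. by move=> /qpi_rel ->; rewrite linearD /= !qpiM. Qed.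

Lemma qpi_relZD a c x y : S (a - (c *: x + y)) -> qpi a = c *: qpi x + qpi y.
Proof. by move=> /qpi_rel ->; rewrite linearP. Qed.

End QuotientAlgebra.

Section FreeAlgebra.
Variables (k : fieldType) (I : choiceType).

Definition free_alg := {malg k[{fmonom I}]}.

HB.instance Definition _ := GRing.Lalgebra.on free_alg.

Definition free_mon (w : {fmonom I}) : free_alg := << w >>.

Definition free_gen (i : I) : free_alg := free_mon (fmu i).

Lemma free_alg_scalerAr (c : k) (x y : free_alg) : c *: (x * y) = x * (c *: y).
Proof.
have gen (E : lalgType k) (z u v : E) : (forall w, c *: w = z * w) ->
    z * u = u * z -> c *: (u * v) = u * (c *: v).
  by move=> zE zu; rewrite !zE mulrA zu mulrA.
apply: (gen free_alg (c%:MP : free_alg)) => [g|]; first exact/esym/mul_malgC.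
rewrite [x]monalgE mulr_sumr mulr_suml; apply: eq_bigr => m _.
by rewrite !malgM_def !fgmulUU mulm1 mul1m mulrC.
Qed.

HB.instance Definition _ :=
  GRing.Lalgebra_isAlgebra.Build k free_alg free_alg_scalerAr.

Lemma free_monM v w : free_mon v * free_mon w = free_mon (mmul v w).
Proof. by rewrite /free_mon malgM_def fgmulUU mulr1. Qed.

Lemma free_alg_ind (P : free_alg -> Prop) :
    P 0 -> (forall c w (g : free_alg), P g -> P (c *: free_mon w + g)) ->
  forall g, P g.
Proof. exact: malg_ind. Qed.

End FreeAlgebra.

Arguments free_mon {k I} w.
Arguments free_gen {k I} i.

HB.mixin Record isPoissonAlgebra (k : fieldType) A
    of GRing.ComAlgebra k A := {
  pbracket : A -> A -> A;
  pbracket_bilinear : bilinear_for *:%R *:%R pbracket;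
  pbracketxx : forall a, pbracket a a = 0;
  pbracket_jacobi : forall a b c,
    pbracket a (pbracket b c) + pbracket b (pbracket c a)
      + pbracket c (pbracket a b) = 0;
  pbracketM : forall a b c,
    pbracket a (b * c) = pbracket a b * c + b * pbracket a c
}.

#[short(type="poissonAlgType")]
HB.structure Definition PoissonAlgebra (k : fieldType) :=
  {A of GRing.ComAlgebra k A & isPoissonAlgebra k A}.

(* inl a and inr a index the generators mu_a and nu_a *)

Section PoissonEnveloping.
Variables (k : fieldType) (A : poissonAlgType k).

Local Notation F := (free_alg k (A + A)%type).
Let m (a : A) : F := free_gen (inl a).
Let n (a : A) : F := free_gen (inr a).

Inductive penv_rel : F -> Prop :=
| penv_mu_linear (c : k) a b : penv_rel (m (c *: a + b) - (c *: m a + m b))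
| penv_nu_linear (c : k) a b : penv_rel (n (c *: a + b) - (c *: n a + n b))
| penv_muM a b : penv_rel (m (a * b) - m a * m b)
| penv_mu_bracket a b : penv_rel (m (pbracket a b) - (n a * m b - m b * n a))
| penv_mu1 : penv_rel (m 1 - 1)
| penv_nuM a b : penv_rel (n (a * b) - (m b * n a + m a * n b))
| penv_nu_bracket a b : penv_rel (n (pbracket a b) - (n a * n b - n b * n a)).

Definition penv := qalg penv_rel.

HB.instance Definition _ := GRing.Lmodule.on penv.
HB.instance Definition _ := GRing.PzRing.on penv.

(* U(A) acts on A by mu_a x = a * x and nu_a x = {a, x}, so U(A) is nonzero *)

Let gen_act (g : A + A) (x : A) : A :=
  match g with inl a => a * x | inr a => pbracket a x end.
Let mon_act (x : A) (w : {fmonom (A + A)%type}) : A := foldr gen_act x w.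
Let act (g : F) (x : A) : A := mlift (mon_act x) g.

Let brDl a b c : pbracket (a + b) c = pbracket a c + pbracket b c :> A.
Proof. by have /= := (pbracket_bilinear (s:=A)).1 c 1 a b; rewrite !scale1r. Qed.

Let brDr a b c : pbracket a (b + c) = pbracket a b + pbracket a c :> A.
Proof. by have /= := (pbracket_bilinear (s:=A)).2 a 1 b c; rewrite !scale1r. Qed.

Let brZDl c a b x : pbracket (c *: a + b) x = c *: pbracket a x + pbracket b x :> A.
Proof. exact: (pbracket_bilinear (s:=A)).1. Qed.

Let brZDr c a x y : pbracket a (c *: x + y) = c *: pbracket a x + pbracket a y :> A.
Proof. exact: (pbracket_bilinear (s:=A)).2. Qed.

Let brC a b : pbracket a b = - pbracket b a :> A.
Proof.
apply/eqP; rewrite -addr_eq0; apply/eqP; have := pbracketxx (a + b).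
by rewrite brDl !brDr !pbracketxx add0r addr0.
Qed.

Let brNr a b : pbracket a (- b) = - pbracket a b :> A.
Proof.
have br0 : pbracket a 0 = 0 by apply: (addrI (pbracket a 0)); rewrite -brDr !addr0.
by apply/eqP; rewrite -addr_eq0 -brDr addNr br0.
Qed.

Let mon_act_linear w : linear (mon_act^~ w).
Proof.
move=> c x y; rewrite /mon_act; elim: (fmonom_val w) => //= g s ->.
by case: g => a /=; rewrite ?brZDr // mulrDr scalerAr.
Qed.

Let actU w x : act (free_mon w) x = mon_act x w. Proof. exact: mliftU. Qed.

Let actZD c g h x : act (c *: g + h) x = c *: act g x + act h x.
Proof. exact: mlift_is_linear. Qed.

Let act0 x : act 0 x = 0.
Proof. exact: (linear0 (mlift (mon_act x))). Qed.

Let actr c g x y : act g (c *: x + y) = c *: act g x + act g y.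
Proof.
elim/free_alg_ind: g => [|d w g IHg]; first by rewrite !act0 scaler0 addr0.
rewrite !actZD IHg !actU mon_act_linear !scalerDr !scalerA mulrC -!addrA.
by congr (_ + _); rewrite addrCA.
Qed.

Let act_0 g : act g 0 = 0.
Proof.
by have := actr 1 g 0 0; rewrite !scale1r addr0 -{1}[act g 0]addr0 => /addrI.
Qed.

Let actM_gen (E : algType k) (f : E -> A -> A) x c w g :
    (forall c g h y, f (c *: g + h) y = c *: f g y + f h y) ->
    (forall c g x y, f g (c *: x + y) = c *: f g x + f g y) ->
  (forall h, f (w * h) x = f w (f h x) -> f (g * h) x = f g (f h x) ->
     f ((c *: w + g) * h) x = f (c *: w + g) (f h x)) /\
  (forall h, f (h * w) x = f h (f w x) -> f (h * g) x = f h (f g x) ->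
     f (h * (c *: w + g)) x = f h (f (c *: w + g) x)).
Proof.
move=> fZD fr; split=> h wh gh.
  by rewrite mulrDl -scalerAl !fZD wh gh.
by rewrite mulrDr -scalerAr !fZD fr wh gh.
Qed.

Let actM g h x : act (g * h) x = act g (act h x).
Proof.
elim/free_alg_ind: g => [|c w g IHg]; first by rewrite mul0r !act0.
apply: (proj1 (actM_gen x c (free_mon w) g actZD actr)) => // {g IHg}.
elim/free_alg_ind: h => [|d v h IHh]; first by rewrite mulr0 !act0 act_0.
apply: (proj2 (actM_gen x d (free_mon v) h actZD actr)) => // {h IHh}.
by rewrite free_monM !actU /mon_act fmM foldr_cat.
Qed.

Let act1 x : act 1 x = x.
Proof. by rewrite [act _ _]actU /mon_act fm1. Qed.

Let actm a x : act (m a) x = a * x.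
Proof. by rewrite actU /mon_act fmU. Qed.

Let actn a x : act (n a) x = pbracket a x.
Proof. by rewrite actU /mon_act fmU. Qed.

Let act_rel_gen (E : algType k) (m' n' : A -> E) (f : E -> A -> A) x :
    (forall c g h y, f (c *: g + h) y = c *: f g y + f h y) ->
    (forall g h y, f (g * h) y = f g (f h y)) -> (forall y, f 1 y = y) ->
    (forall a y, f (m' a) y = a * y) -> (forall a y, f (n' a) y = pbracket a y) ->
  [/\ forall c a b, f (m' (c *: a + b) - (c *: m' a + m' b)) x = 0,
      forall c a b, f (n' (c *: a + b) - (c *: n' a + n' b)) x = 0,
      forall a b, f (m' (a * b) - m' a * m' b) x = 0,
      forall a b, f (m' (pbracket a b) - (n' a * m' b - m' b * n' a)) x = 0 &
   [/\ f (m' 1 - 1) x = 0,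
      forall a b, f (n' (a * b) - (m' b * n' a + m' a * n' b)) x = 0 &
      forall a b, f (n' (pbracket a b) - (n' a * n' b - n' b * n' a)) x = 0]].
Proof.
move=> fZD fM f1 fm fn.
have fD h h' y : f (h + h') y = f h y + f h' y.
  by have := fZD 1 h h' y; rewrite !scale1r.
have fB h h' y : f (h - h') y = f h y - f h' y.
  by rewrite -(scaleN1r h') addrC fZD addrC scaleN1r.
split; [move=> c a b|move=> c a b|move=> a b|move=> a b|
  split; [|move=> a b|move=> a b]]; rewrite fB.
- by rewrite fZD !fm mulrDl scalerAl subrr.
- by rewrite fZD !fn brZDl subrr.
- by rewrite fM !fm mulrA subrr.
- by rewrite fB !fM !fm !fn pbracketM addrK subrr.
- by rewrite fm f1 mul1r subrr.
- rewrite fD !fM !fm !fn (brC (a * b)) pbracketM (brC x a) (brC x b).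
  by rewrite mulNr mulrN opprD !opprK (mulrC _ b) subrr.
- rewrite fB !fM !fn; apply/eqP; rewrite subr_eq0.
  have /eqP := pbracket_jacobi a b x.
  rewrite (brC x a) (brC x (pbracket a b)) subr_eq0 => /eqP <-.
  by rewrite brNr.
Qed.

Let act_rel g x : penv_rel g -> act g x = 0.
Proof.
have [r1 r2 r3 r4 [r5 r6 r7]] := act_rel_gen x actZD actM act1 actm actn.
case=> [c a b|c a b|a b|a b||a b|a b];
  [exact: r1|exact: r2|exact: r3|exact: r4|exact: r5|exact: r6|exact: r7].
Qed.

Lemma penv_1_neq0 : 1 != 0 :> penv.
Proof.
apply/eqP => E10.
have /qclassP : qpi penv_rel 1 = qpi penv_rel 0 by rewrite linear0.
rewrite subr0 => I1 {E10}.
suff actI0 g x : span (ideal_span penv_rel) g -> act g x = 0.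
  by have /eqP := actI0 _ 1 I1; rewrite act1 (negPf (oner_neq0 A)).
elim=> [|c _ h [u r v Rr] _ IHh]; first exact: act0.
by rewrite actZD IHh !actM (act_rel _ Rr) act_0 scaler0 addr0.
Qed.

HB.instance Definition _ := GRing.PzSemiRing_isNonZero.Build penv penv_1_neq0.
HB.instance Definition _ :=
  GRing.Lmodule_isLalgebra.Build k penv (@qscalerAl _ _ penv_rel).
HB.instance Definition _ :=
  GRing.Lalgebra_isAlgebra.Build k penv (@qscalerAr _ _ penv_rel).

Definition pmu (a : A) : penv := qpi penv_rel (m a).
Definition pnu (a : A) : penv := qpi penv_rel (n a).

Lemma pmu_is_linear : linear pmu.
Proof. move=> c a b; exact: (qpi_relZD (penv_mu_linear c a b)). Qed.

Lemma pnu_is_linear : linear pnu.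
Proof. move=> c a b; exact: (qpi_relZD (penv_nu_linear c a b)). Qed.

Lemma pmuM a b : pmu (a * b) = pmu a * pmu b.
Proof. exact: (qpi_relM (penv_muM a b)). Qed.

Lemma pmu_bracket a b : pmu (pbracket a b) = pnu a * pmu b - pmu b * pnu a.
Proof. exact: (qpi_relMB (penv_mu_bracket a b)). Qed.

Lemma pmu1 : pmu 1 = 1.
Proof. exact: (qpi_rel penv_mu1). Qed.

Lemma pnuM a b : pnu (a * b) = pmu b * pnu a + pmu a * pnu b.
Proof. exact: (qpi_relMD (penv_nuM a b)). Qed.

Lemma pnu_bracket a b : pnu (pbracket a b) = pnu a * pnu b - pnu b * pnu a.
Proof. exact: (qpi_relMB (penv_nu_bracket a b)). Qed.

End PoissonEnveloping.

Arguments pmu {k A} a.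
Arguments pnu {k A} a.

Definition tmul (k : fieldType) (B : algType k) (s t : tensor B B) : tensor B B :=
  tlift (fun a b => tlift (fun c d => tens (a * c) (b * d)) t) s.

Definition tassoc (k : fieldType) (U V W : lmodType k)
    (t : tensor (tensor U V) W) : tensor U (tensor V W) :=
  tlift (fun s w => tlift (fun u v => tens u (tens v w)) s) t.

HB.mixin Record isHopfAlgebra (k : fieldType) H of GRing.Algebra k H := {
  comul : {linear H -> tensor H H};
  counit : {linear H -> k^o};
  antipode : {linear H -> H};
  comulA : forall h,
    tassoc (tlift (fun x y => tens (comul x) y) (comul h))
      = tlift (fun x y => tens x (comul y)) (comul h);
  counitl : forall h, tlift (fun x y => counit x *: y) (comul h) = h;
  counitr : forall h, tlift (fun x y => counit y *: x) (comul h) = h;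
  comul1 : comul 1 = tens 1 1;
  comulM : forall g h, comul (g * h) = tmul (comul g) (comul h);
  counit1 : counit 1 = 1;
  counitM : forall g h, counit (g * h) = counit g * counit h;
  antipodel : forall h, tlift (fun x y => antipode x * y) (comul h) = (counit h)%:A;
  antipoder : forall h, tlift (fun x y => x * antipode y) (comul h) = (counit h)%:A
}.

#[short(type="hopfAlgType")]
HB.structure Definition HopfAlgebra (k : fieldType) :=
  {H of GRing.Algebra k H & isHopfAlgebra k H}.

(* Sweedler notation: h1 and h2 are the two legs of the coproduct of h; the   *)
(* body must be bilinear in (h1, h2)                                          *)
Notation "\sweedler_ ( h1 , h2 <- h ) E" := (tlift (fun h1 h2 => E) (comul h))
  (at level 36, h1 name, h2 name, h at level 60, E at level 36,
   format "\sweedler_ ( h1 ,  h2  <-  h )  E") : ring_scope.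

Section HopfActions.
Variables (k : fieldType) (H : hopfAlgType k).

Record is_module (M : lmodType k) (act : H -> M -> M) : Prop := {
  act_linearl : forall x, linear (act^~ x);
  act_linearr : forall h, linear (act h);
  act1 : forall x, act 1 x = x;
  actM : forall g h x, act (g * h) x = act g (act h x)
}.

Record is_module_algebra (B : algType k) (act : H -> B -> B) : Prop := {
  module_algebra_module : is_module act;
  module_algebra_one : forall h, act h 1 = counit h *: 1;
  module_algebra_mul : forall h x y,
    act h (x * y) = \sweedler_(h1, h2 <- h) (act h1 x * act h2 y)
}.

Record is_module_poisson_algebra (A : poissonAlgType k) (act : H -> A -> A)
  : Prop := {
  module_poisson_algebra : is_module_algebra act;
  module_poisson_bracket : forall h a b,
    act h (pbracket a b) = \sweedler_(h1, h2 <- h) pbracket (act h1 a) (act h2 b)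
}.

End HopfActions.

(* Main.v *)
(* If H acts on U(A), applying h to the relations for nu_(ab) and nu_{a,b},    *)
(* expanding both sides with the coproduct and cancelling the common terms    *)
(* gives the two identities. Conversely, Hom(H, U(A)) is an algebra under     *)
(* convolution, and the generators a |-> (h |-> mu_(h.a)), (h |-> nu_(h.a))   *)
(* extend to a morphism from the free algebra to it. The two identities are   *)
(* what is needed for it to kill the relations of U(A); the induced map       *)
(* U(A) -> Hom(H, U(A)), u |-> (h |-> h.u), is multiplicative by construction,*)
(* and associativity of the action then only has to be checked on generators. *)

Require Import Defs.
From HB Require Import structures.
From mathcomp Require Import all_boot all_order all_algebra.
From mathcomp Require Import boolp.
From mathcomp.multinomials Require Import monalg.

Set Implicit Arguments.
Unset Strict Implicit.
Unset Printing Implicit Defensive.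

Import GRing.Theory.
Local Open Scope ring_scope.

Local Notation bilin f := (bilinear_for *:%R *:%R f).

Section LinearMaps.
Variables (k : fieldType) (U V : lmodType k) (f : U -> V).
Hypothesis fL : linear f.

Lemma linear_fun0 : f 0 = 0.
Proof. by have := fL (-1) 0 0; rewrite !scaleN1r !addNr. Qed.

Lemma linear_funD x y : f (x + y) = f x + f y.
Proof. by have := fL 1 x y; rewrite !scale1r. Qed.

Lemma linear_funZ c x : f (c *: x) = c *: f x.
Proof. by have := fL c x 0; rewrite linear_fun0 !addr0. Qed.

Lemma linear_funB x y : f (x - y) = f x - f y.
Proof. by rewrite linear_funD -scaleN1r linear_funZ scaleN1r. Qed.

Lemma linear_fun_sum (I : Type) (r : seq I) (F : I -> U) :
  f (\sum_(i <- r) F i) = \sum_(i <- r) f (F i).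
Proof. exact: (big_morph f linear_funD linear_fun0). Qed.

End LinearMaps.

Lemma linear_fun_comp (k : fieldType) (U V W : lmodType k) (f : V -> W)
    (g : U -> V) :
  linear f -> linear g -> linear (fun x => f (g x)).
Proof. by move=> fL gL c x y; rewrite gL fL. Qed.

Section TensorLift.
Variables (k : fieldType) (U V : lmodType k).
Implicit Type t : tensor U V.

Lemma eq_tlift (W : lmodType k) (f g : U -> V -> W) t :
  (forall u v, f u v = g u v) -> tlift f t = tlift g t.
Proof. by move=> fg; apply: eq_bigr => p _; rewrite fg. Qed.

Lemma tliftP (W : lmodType k) c (f g : U -> V -> W) t :
  tlift (fun u v => c *: f u v + g u v) t = c *: tlift f t + tlift g t.
Proof.
rewrite /tlift /mlift scaler_sumr -big_split /=; apply: eq_bigr => p _.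
by rewrite scalerDr !scalerA mulrC.
Qed.

Lemma tliftD (W : lmodType k) (f g : U -> V -> W) t :
  tlift (fun u v => f u v + g u v) t = tlift f t + tlift g t.
Proof.
rewrite -[tlift f t]scale1r -tliftP; apply: eq_tlift => u v.
by rewrite scale1r.
Qed.

Lemma tliftB (W : lmodType k) (f g : U -> V -> W) t :
  tlift (fun u v => f u v - g u v) t = tlift f t - tlift g t.
Proof.
rewrite addrC -scaleN1r -tliftP; apply: eq_tlift => u v.
by rewrite scaleN1r addrC.
Qed.

(* No bilinearity of f is needed: [tlift f t] is a fixed finite combination   *)
(* of values of f, taken at the chosen representative of t.                   *)
Lemma linear_tlift (W X : lmodType k) (L : W -> X) (f : U -> V -> W) t :
  linear L -> L (tlift f t) = tlift (fun u v => L (f u v)) t.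
Proof.
move=> LL; rewrite /tlift /mlift linear_fun_sum //.
by apply: eq_bigr => p _; rewrite linear_funZ.
Qed.

Lemma tlift_exchange (U' V' W : lmodType k) (F : U -> V -> U' -> V' -> W) t
    (t' : tensor U' V') :
  tlift (fun u v => tlift (F u v) t') t
    = tlift (fun u' v' => tlift (fun u v => F u v u' v') t) t'.
Proof.
rewrite /tlift /mlift.
under eq_bigr do rewrite scaler_sumr.
rewrite exchange_big; apply: eq_bigr => p _; rewrite scaler_sumr.
by apply: eq_bigr => q _; rewrite !scalerA mulrC.
Qed.

Lemma tens_bilin : bilin (@tens k U V).
Proof. exact: tens_is_bilinear. Qed.

Lemma tensor_eq_linear (W : lmodType k) (L M : tensor U V -> W) :
  linear L -> linear M -> (forall u v, L (tens u v) = M (tens u v)) -> L =1 M.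
Proof.
move=> LL ML LM t; elim/tens_ind: t => [c u v t IHt|].
  by rewrite LL ML IHt LM.
by rewrite !linear_fun0.
Qed.

Lemma tlift_tlift_tens (U' V' W : lmodType k) (G : U' -> V' -> W)
    (p : U -> V -> U') (q : U -> V -> V') t : bilin G ->
  tlift G (tlift (fun u v => tens (p u v) (q u v)) t)
    = tlift (fun u v => G (p u v) (q u v)) t.
Proof.
move=> GL; rewrite (linear_tlift _ _ (tlift_is_linear GL)).
by apply: eq_tlift => u v; rewrite tliftE.
Qed.

End TensorLift.

Arguments tens_bilin {k U V}.

Lemma bilin_mul (k : fieldType) (B : algType k) (U V : lmodType k)
    (f : U -> B) (g : V -> B) :
  linear f -> linear g -> bilin (fun u v => f u * g v).
Proof.
move=> fL gL; split=> [v c x y|u c x y] /=.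
  by rewrite fL mulrDl scalerAl.
by rewrite gL mulrDr scalerAr.
Qed.

Section TensorAssociativity.
Variables (k : fieldType).

Lemma tassoc_bilin (U V W : lmodType k) :
  bilin (fun s w => tlift (fun u v => tens u (tens v w)) s
                    : tensor U (tensor V W)).
Proof.
split=> [w|s].
  apply: tlift_is_linear; split=> [v c x y|u c x y] /=.
    by rewrite tens_bilin.1.
  by rewrite tens_bilin.1 tens_bilin.2.
move=> c x y /=; rewrite -tliftP; apply: eq_tlift => u v.
by rewrite tens_bilin.2 tens_bilin.2.
Qed.

Lemma tassoc_linear (U V W : lmodType k) : linear (@tassoc k U V W).
Proof. exact/tlift_is_linear/tassoc_bilin. Qed.

Lemma tassocE (U V W : lmodType k) (s : tensor U V) (w : W) :
  tassoc (tens s w) = tlift (fun u v => tens u (tens v w)) s.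
Proof. by rewrite /tassoc tliftE //; exact: tassoc_bilin. Qed.

End TensorAssociativity.

Section Convolution.
Variables (k : fieldType) (H : hopfAlgType k) (B : algType k).
Implicit Types f g e : H -> B.

Definition conv f g (h : H) : B := \sweedler_(h1, h2 <- h) (f h1 * g h2).

Definition conv_unit (h : H) : B := counit h *: 1.

Lemma comul_linear : linear (@comul k H).
Proof. exact: linearP. Qed.

Lemma conv_unit_linear : linear conv_unit.
Proof. by move=> c x y; rewrite /conv_unit linearP scalerDl scalerA. Qed.

Lemma sweedler_linear (W : lmodType k) (F : H -> H -> W) :
  bilin F -> linear (fun h => tlift F (comul h)).
Proof. by move=> FL c x y; rewrite comul_linear tlift_is_linear. Qed.

Lemma conv_linear f g : linear f -> linear g -> linear (conv f g).
Proof. by move=> fL gL; exact/sweedler_linear/bilin_mul. Qed.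

Lemma sweedler_counitl (W : lmodType k) (f : H -> W) h :
  linear f -> \sweedler_(h1, h2 <- h) (counit h1 *: f h2) = f h.
Proof.
move=> fL; rewrite -[in RHS](counitl h) linear_tlift //.
by apply: eq_tlift => x y; rewrite linear_funZ.
Qed.

Lemma sweedler_counitr (W : lmodType k) (f : H -> W) h :
  linear f -> \sweedler_(h1, h2 <- h) (counit h2 *: f h1) = f h.
Proof.
move=> fL; rewrite -[in RHS](counitr h) linear_tlift //.
by apply: eq_tlift => x y; rewrite linear_funZ.
Qed.

Lemma conv1l f : linear f -> conv conv_unit f = f.
Proof.
move=> fL; apply/funext => h; rewrite -[RHS]sweedler_counitl //.
by apply: eq_tlift => x y; rewrite /conv_unit -scalerAl mul1r.
Qed.

Lemma conv1r f : linear f -> conv f conv_unit = f.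
Proof.
move=> fL; apply/funext => h; rewrite -[RHS]sweedler_counitr //.
by apply: eq_tlift => x y; rewrite /conv_unit -scalerAr mulr1.
Qed.

Lemma convA f g e : linear f -> linear g -> linear e ->
  conv (conv f g) e = conv f (conv g e).
Proof.
move=> fL gL eL; apply/funext => h.
pose fg := tlift (fun u v : H => f u * g v).
pose ge := tlift (fun u v : H => g u * e v).
have fgL : linear fg by exact/tlift_is_linear/bilin_mul.
have geL : linear ge by exact/tlift_is_linear/bilin_mul.
pose P := fun s w => fg s * e w; pose Q := fun u s => f u * ge s.
have PL : bilin P by exact: bilin_mul.
have QL : bilin Q by exact: bilin_mul.
have PQ t : tlift P t = tlift Q (tassoc t).
  have QaL : linear (fun s => tlift Q (tassoc s)).
    exact/(linear_fun_comp (tlift_is_linear QL))/tassoc_linear.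
  move: t; apply: (tensor_eq_linear (tlift_is_linear PL) QaL) => s w.
  rewrite tliftE // tassocE tlift_tlift_tens // /P /fg.
  rewrite (linear_tlift (L := fun b => b * e w)) //; last first.
    by move=> c x y; rewrite mulrDl scalerAl.
  by apply: eq_tlift => u v; rewrite /Q /ge tliftE ?mulrA //; exact: bilin_mul.
rewrite /conv -[LHS](tlift_tlift_tens (fun x _ => comul x) (fun _ y => y) _ PL).
rewrite -[RHS](tlift_tlift_tens (fun x _ => x) (fun _ y => comul y) _ QL).
by rewrite PQ comulA.
Qed.

End Convolution.

Lemma fmonom_ind (I : choiceType) (P : {fmonom I} -> Prop) :
    P (mone : {fmonom I}) -> (forall i w, P w -> P (mmul (fmu i) w)) ->
  forall w, P w.
Proof.
move=> P1 PM [s]; elim: s => [|i s IHs].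
  by have <- : mone = FMonom [::] :> {fmonom I} by apply: val_inj; rewrite /= fm1.
have <- : mmul (fmu i) (FMonom s) = FMonom (i :: s).
  by apply: val_inj; rewrite /= fmM fmU.
exact: PM.
Qed.

Lemma free_alg_eq_linear (k : fieldType) (I : choiceType) (W : lmodType k)
    (f g : free_alg k I -> W) :
    linear f -> linear g -> (forall w, f (free_mon w) = g (free_mon w)) ->
  f =1 g.
Proof.
move=> fL gL fg x; elim/free_alg_ind: x => [|c w x IHx].
  by rewrite !linear_fun0.
by rewrite fL gL IHx fg.
Qed.

Section FreeConvolution.
Variables (k : fieldType) (H : hopfAlgType k) (B : algType k) (I : choiceType).
Variable gen : I -> H -> B.
Hypothesis gen_linear : forall i, linear (gen i).

Definition word_lift (w : {fmonom I}) : H -> B :=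
  foldr (fun i => conv (gen i)) (@conv_unit k H B) w.

Definition free_lift (x : free_alg k I) (h : H) : B :=
  mlift (word_lift^~ h) x.

Lemma word_lift_linear w : linear (word_lift w).
Proof.
rewrite /word_lift; elim: (fmonom_val w) => [|i s IHs] /=.
  exact: conv_unit_linear.
exact: conv_linear.
Qed.

Lemma word_liftM v w :
  word_lift (mmul v w) = conv (word_lift v) (word_lift w).
Proof.
rewrite {1 2}/word_lift fmM foldr_cat -/(word_lift w).
elim: (fmonom_val v) => [|i s /= ->].
  by rewrite conv1l //; exact: word_lift_linear.
rewrite convA //; last exact: word_lift_linear.
exact: (word_lift_linear (FMonom s)).
Qed.

Lemma free_lift_linear h : linear (free_lift^~ h).
Proof. exact: mlift_is_linear. Qed.

Lemma free_lift_linearr x : linear (free_lift x).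
Proof.
elim/free_alg_ind: x => [|c w x IHx] d g h.
  by rewrite !(linear_fun0 (free_lift_linear _)) scaler0 addr0.
rewrite !free_lift_linear IHx /free_lift !mliftU word_lift_linear.
by rewrite !scalerDr !scalerA mulrC addrACA.
Qed.

Lemma free_lift_mon w : free_lift (free_mon w) = word_lift w.
Proof. by apply/funext => h; exact: mliftU. Qed.

Lemma free_lift1 : free_lift 1 = @conv_unit k H B.
Proof. by rewrite [LHS]free_lift_mon /word_lift fm1. Qed.

Lemma free_lift_gen i : free_lift (free_gen i) = gen i.
Proof. by rewrite free_lift_mon /word_lift fmU /= conv1r. Qed.

Lemma conv_free_lift_linearl (f : H -> B) h :
  linear (fun x => conv (free_lift x) f h).
Proof.
move=> c x y; rewrite /conv -tliftP; apply: eq_tlift => h1 h2.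
by rewrite free_lift_linear mulrDl scalerAl.
Qed.

Lemma conv_free_lift_linearr (f : H -> B) h :
  linear (fun x => conv f (free_lift x) h).
Proof.
move=> c x y; rewrite /conv -tliftP; apply: eq_tlift => h1 h2.
by rewrite free_lift_linear mulrDr scalerAr.
Qed.

Lemma free_liftM x y : free_lift (x * y) = conv (free_lift x) (free_lift y).
Proof.
apply/funext => h; move: x; apply: free_alg_eq_linear => [c x z||v].
- by rewrite mulrDl -scalerAl free_lift_linear.
- exact: conv_free_lift_linearl.
move: y; apply: free_alg_eq_linear => [c x z||w].
- by rewrite mulrDr -scalerAr free_lift_linear.
- exact: conv_free_lift_linearr.
by rewrite free_monM !free_lift_mon word_liftM.
Qed.

Lemma free_lift_ideal (S : free_alg k I -> Prop) x h :
    (forall r h', S r -> free_lift r h' = 0) ->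
  Defs.span (ideal_span S) x -> free_lift x h = 0.
Proof.
move=> S0; elim=> [|c _ y [u r v Sr] _ IHy].
  exact: linear_fun0 (free_lift_linear h).
have r0 : free_lift r = free_lift 0.
  by apply/funext => h'; rewrite S0 // (linear_fun0 (free_lift_linear h')).
rewrite free_lift_linear IHy !free_liftM r0 -!free_liftM mulr0 mul0r.
by rewrite (linear_fun0 (free_lift_linear h)) scaler0 addr0.
Qed.

End FreeConvolution.

Section PoissonEnvelopingProjection.
Variables (k : fieldType) (A : poissonAlgType k).

Definition penv_pi (x : free_alg k (A + A)%type) : penv A :=
  qpi (@penv_rel k A) x.

Lemma qreprK_penv : cancel (fun u : penv A => qrepr u) penv_pi.
Proof. exact: (@qreprK _ _ (ideal_span (@penv_rel k A))). Qed.

Lemma penv_pi_linear : linear penv_pi.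
Proof. exact: qclass_is_linear. Qed.

Lemma penv_piM x y : penv_pi (x * y) = penv_pi x * penv_pi y.
Proof. exact: qpiM. Qed.

Lemma penv_pi1 : penv_pi 1 = 1.
Proof. by []. Qed.

End PoissonEnvelopingProjection.

Lemma penv_ind (k : fieldType) (A : poissonAlgType k) (P : penv A -> Prop) :
    (forall c x y, P x -> P y -> P (c *: x + y)) ->
    P 1 -> (forall x y, P x -> P y -> P (x * y)) ->
    (forall a, P (pmu a)) -> (forall a, P (pnu a)) ->
  forall u, P u.
Proof.
move=> PL P1 PM Pmu Pnu u.
have P0 : P 0 by have := PL (-1) _ _ P1 P1; rewrite scaleN1r addNr.
have piL := @penv_pi_linear k A.
rewrite -[u]qreprK_penv.
elim/free_alg_ind: (qrepr u) => [|c w x IHx]; first by rewrite (linear_fun0 piL).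
rewrite piL; apply: (PL) => //.
elim/fmonom_ind: w => [|g w IHw]; first by have := P1; rewrite -penv_pi1.
rewrite -free_monM penv_piM.
by apply: PM; [case: g => a; [exact: Pmu | exact: Pnu] |].
Qed.

Lemma sweedler_mul (k : fieldType) (H : hopfAlgType k) (W : lmodType k)
    (G : H -> H -> W) g h : bilin G ->
  \sweedler_(x, y <- g * h) G x y
    = \sweedler_(g1, g2 <- g) \sweedler_(h1, h2 <- h) G (g1 * h1) (g2 * h2).
Proof.
move=> GL; rewrite comulM /tmul (linear_tlift _ _ (tlift_is_linear GL)).
by apply: eq_tlift => g1 g2; rewrite tlift_tlift_tens.
Qed.

Section PoissonEnvelopingAction.
Variables (k : fieldType) (H : hopfAlgType k) (A : poissonAlgType k).
Variables (act : H -> A -> A).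
Hypothesis actP : is_module_poisson_algebra act.

Let act_alg := module_poisson_algebra actP.
Let act_mod := module_algebra_module act_alg.

Lemma pmu_act_linear a : linear (fun h => pmu (act h a)).
Proof. exact: linear_fun_comp (@pmu_is_linear k A) (act_linearl act_mod a). Qed.

Lemma pnu_act_linear a : linear (fun h => pnu (act h a)).
Proof. exact: linear_fun_comp (@pnu_is_linear k A) (act_linearl act_mod a). Qed.

Lemma pmu_actM h a b :
  pmu (act h (a * b))
    = \sweedler_(h1, h2 <- h) (pmu (act h1 a) * pmu (act h2 b)).
Proof.
rewrite (module_algebra_mul act_alg) (linear_tlift _ _ (@pmu_is_linear k A)).
by apply: eq_tlift => x y; rewrite pmuM.
Qed.

Lemma pmu_act_bracket h a b :
  pmu (act h (pbracket a b))
    = \sweedler_(h1, h2 <- h) (pnu (act h1 a) * pmu (act h2 b))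
      - \sweedler_(h1, h2 <- h) (pmu (act h2 b) * pnu (act h1 a)).
Proof.
rewrite (module_poisson_bracket actP) (linear_tlift _ _ (@pmu_is_linear k A)).
by rewrite -tliftB; apply: eq_tlift => x y; rewrite pmu_bracket.
Qed.

Lemma pnu_actM h a b :
  pnu (act h (a * b))
    = \sweedler_(h1, h2 <- h) (pmu (act h2 b) * pnu (act h1 a))
      + \sweedler_(h1, h2 <- h) (pmu (act h1 a) * pnu (act h2 b)).
Proof.
rewrite (module_algebra_mul act_alg) (linear_tlift _ _ (@pnu_is_linear k A)).
by rewrite -tliftD; apply: eq_tlift => x y; rewrite pnuM.
Qed.

Lemma pnu_act_bracket h a b :
  pnu (act h (pbracket a b))
    = \sweedler_(h1, h2 <- h) (pnu (act h1 a) * pnu (act h2 b))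
      - \sweedler_(h1, h2 <- h) (pnu (act h2 b) * pnu (act h1 a)).
Proof.
rewrite (module_poisson_bracket actP) (linear_tlift _ _ (@pnu_is_linear k A)).
by rewrite -tliftB; apply: eq_tlift => x y; rewrite pnu_bracket.
Qed.

Definition penv_gen_act (g : A + A) (h : H) : penv A :=
  match g with inl a => pmu (act h a) | inr a => pnu (act h a) end.

Lemma penv_gen_act_linear g : linear (penv_gen_act g).
Proof. by case: g => a; [exact: pmu_act_linear | exact: pnu_act_linear]. Qed.

Local Notation lift := (free_lift penv_gen_act).

Hypothesis mu_nu_sym : forall (h : H) (a b : A),
  \sweedler_(h1, h2 <- h) (pmu (act h1 b) * pnu (act h2 a))
    = \sweedler_(h1, h2 <- h) (pmu (act h2 b) * pnu (act h1 a)).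
Hypothesis nu_nu_sym : forall (h : H) (a b : A),
  \sweedler_(h1, h2 <- h) (pnu (act h2 b) * pnu (act h1 a))
    = \sweedler_(h1, h2 <- h) (pnu (act h1 b) * pnu (act h2 a)).

Lemma free_lift_gen_mul i j h :
  lift (free_gen i * free_gen j) h
    = \sweedler_(h1, h2 <- h) (penv_gen_act i h1 * penv_gen_act j h2).
Proof.
by rewrite (free_liftM penv_gen_act_linear) !(free_lift_gen penv_gen_act_linear).
Qed.

Lemma free_lift_penv_rel r h : penv_rel r -> lift r h = 0.
Proof.
have liftL := free_lift_linear penv_gen_act h.
have liftB := linear_funB liftL; have liftD := linear_funD liftL.
have liftE i : lift (free_gen i) h = penv_gen_act i h.
  by rewrite (free_lift_gen penv_gen_act_linear).
have liftM i j := free_lift_gen_mul i j h.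
(* Rewriting twice with [liftM] would make Rocq test the two distinct products *)
(* of generators for convertibility, which does not return.                    *)
have liftMB i j i' j' : lift (free_gen i * free_gen j - free_gen i' * free_gen j') h
    = conv (penv_gen_act i) (penv_gen_act j) h
      - conv (penv_gen_act i') (penv_gen_act j') h.
  by rewrite liftB; congr (_ - _); exact: liftM.
have liftMD i j i' j' : lift (free_gen i * free_gen j + free_gen i' * free_gen j') h
    = conv (penv_gen_act i) (penv_gen_act j) h
      + conv (penv_gen_act i') (penv_gen_act j') h.
  by rewrite liftD; congr (_ + _); exact: liftM.
case=> [c a b|c a b|a b|a b||a b|a b]; rewrite liftB liftE; apply/eqP;
  rewrite subr_eq0; apply/eqP.
- rewrite liftL !liftE [LHS]/= (act_linearr act_mod); exact: pmu_is_linear.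
- rewrite liftL !liftE [LHS]/= (act_linearr act_mod); exact: pnu_is_linear.
- rewrite liftM; exact: pmu_actM.
- rewrite liftMB; apply: etrans (pmu_act_bracket h a b) _.
  by rewrite -mu_nu_sym.
- rewrite free_lift1 [LHS]/= (module_algebra_one act_alg).
  by rewrite (linear_funZ (@pmu_is_linear k A)) pmu1.
- rewrite liftMD; apply: etrans (pnu_actM h a b) _.
  by rewrite -mu_nu_sym.
- rewrite liftMB; apply: etrans (pnu_act_bracket h a b) _.
  by rewrite nu_nu_sym.
Qed.

Definition penv_act (h : H) (u : penv A) : penv A := lift (qrepr u) h.

Lemma penv_actE h x : penv_act h (penv_pi x) = lift x h.
Proof.
have lift0 : lift (qrepr (penv_pi x) - x) h = 0.
  apply: (free_lift_ideal penv_gen_act_linear h free_lift_penv_rel).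
  by apply/qclassP; exact: qreprK_penv.
apply/eqP; rewrite -subr_eq0; apply/eqP.
by rewrite -[RHS]lift0 [RHS](linear_funB (free_lift_linear _ h)).
Qed.

Lemma penv_act_pmu h a : penv_act h (pmu a) = pmu (act h a).
Proof. by rewrite penv_actE (free_lift_gen penv_gen_act_linear). Qed.

Lemma penv_act_pnu h a : penv_act h (pnu a) = pnu (act h a).
Proof. by rewrite penv_actE (free_lift_gen penv_gen_act_linear). Qed.

Lemma penv_act1 h : penv_act h 1 = (counit h : k) *: 1.
Proof. by rewrite -{1}penv_pi1 penv_actE free_lift1. Qed.

Lemma penv_act_linearl u : linear (penv_act^~ u).
Proof. exact: free_lift_linearr penv_gen_act_linear _. Qed.

Lemma penv_act_linearr h : linear (penv_act h).
Proof.
move=> c u v; rewrite -[u]qreprK_penv -[v]qreprK_penv -penv_pi_linear.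
by rewrite !penv_actE free_lift_linear.
Qed.

Lemma penv_actM h u v :
  penv_act h (u * v)
    = \sweedler_(h1, h2 <- h) (penv_act h1 u * penv_act h2 v).
Proof.
rewrite -[in LHS](qreprK_penv u) -[in LHS](qreprK_penv v) -penv_piM penv_actE.
by rewrite free_liftM //; exact: penv_gen_act_linear.
Qed.

Lemma penv_act_id u : penv_act 1 u = u.
Proof.
elim/penv_ind: u => [c x y IHx IHy||x y IHx IHy|a|a].
- by rewrite penv_act_linearr IHx IHy.
- by rewrite penv_act1 counit1 scale1r.
- rewrite penv_actM comul1 tliftE ?IHx ?IHy //.
  exact: bilin_mul (penv_act_linearl x) (penv_act_linearl y).
- by rewrite penv_act_pmu (Defs.act1 act_mod).
- by rewrite penv_act_pnu (Defs.act1 act_mod).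
Qed.

Lemma penv_act_comp g h u : penv_act (g * h) u = penv_act g (penv_act h u).
Proof.
elim/penv_ind: u g h => [c x y IHx IHy||x y IHx IHy|a|a] g h.
- by rewrite !penv_act_linearr IHx IHy.
- by rewrite !penv_act1 (linear_funZ (penv_act_linearr g)) penv_act1
             counitM scalerA mulrC.
- rewrite !penv_actM sweedler_mul; last first.
    exact: bilin_mul (penv_act_linearl x) (penv_act_linearl y).
  rewrite (linear_tlift _ _ (penv_act_linearr g)) tlift_exchange.
  apply: eq_tlift => h1 h2; rewrite penv_actM.
  by apply: eq_tlift => g1 g2; rewrite IHx IHy.
- by rewrite !penv_act_pmu (Defs.actM act_mod).
- by rewrite !penv_act_pnu (Defs.actM act_mod).
Qed.

Lemma penv_act_module_algebra : is_module_algebra penv_act.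
Proof.
split; [split | exact: penv_act1 | exact: penv_actM].
- exact: penv_act_linearl.
- exact: penv_act_linearr.
- exact: penv_act_id.
- exact: penv_act_comp.
Qed.

End PoissonEnvelopingAction.

Theorem theorem3p2 (k : closedFieldType) (char0 : [pchar k] =i pred0)
    (H : hopfAlgType k) (A : poissonAlgType k)
    (act : H -> A -> A) (actP : is_module_poisson_algebra act) :
  (exists uact : H -> penv A -> penv A,
     [/\ is_module_algebra uact,
         forall h a, uact h (pmu a) = pmu (act h a) &
         forall h a, uact h (pnu a) = pnu (act h a)])
  <->
  (forall (h : H) (a b : A),
     \sweedler_(h1, h2 <- h) (pmu (act h1 b) * pnu (act h2 a))
       = \sweedler_(h1, h2 <- h) (pmu (act h2 b) * pnu (act h1 a))
     /\
     \sweedler_(h1, h2 <- h) (pnu (act h2 b) * pnu (act h1 a))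
       = \sweedler_(h1, h2 <- h) (pnu (act h1 b) * pnu (act h2 a))).
Proof.
split=> [[uact [uactP uact_mu uact_nu]] h a b | sym]; last first.
  have mu_nu h a b := (sym h a b).1.
  have nu_nu h a b := (sym h a b).2.
  exists (penv_act act); split.
  - exact: penv_act_module_algebra.
  - exact: penv_act_pmu.
  - exact: penv_act_pnu.
have uactM := module_algebra_mul uactP.
have uactL := act_linearr (module_algebra_module uactP).
split.
  have := uact_nu h (a * b).
  rewrite pnuM (linear_funD (uactL h)) !uactM (pnu_actM actP).
  under eq_tlift do rewrite uact_mu uact_nu.
  under [X in _ + X = _]eq_tlift do rewrite uact_mu uact_nu.
  exact: addIr.
have := uact_nu h (pbracket a b).
rewrite pnu_bracket (linear_funB (uactL h)) !uactM (pnu_act_bracket actP).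
under eq_tlift do rewrite !uact_nu.
under [X in _ - X = _]eq_tlift do rewrite !uact_nu.
by move/addrI/oppr_inj/esym.
Qed.
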